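(* Let $X$ be a Hausdorff topological group with operations and let $G$ be a regular $G$-method for $X$ which preserves the $G$-convergence of subsequences. If $X$ is $G$-compact, then every $G$-continuous map $f\colon X\to X$ is $G$-closed.
   Context: Groups with operations. A category of groups with operations consists of groups (written additively, not necessarily abelian) with a set of operations $\Omega=\Omega_0\cup\Omega_1\cup\Omega_2$ ($\Omega_i$ the $i$-ary operations) and a set of identities including the group laws, such that: $\Omega_0=\{0\}$; $-\in\Omega_1$, $+\in\Omega_2$; with $\Omega_1'=\Omega_1\setminus\{-\}$ and $\Omega_2'=\Omega_2\setminus\{+\}$, if $\star\in\Omega_2'$ then $\star^\circ$, defined by $x\star^\circ y=y\star x$, is in $\Omega_2'$; and for $\star\in\Omega_2'$, $\omega\in\Omega_1'$ the identities $x\star(y+z)=x\star y+x\star z$, $\omega(x+y)=\omega(x)+\omega(y)$, $\omega(x)\star y=\omega(x\star y)$ hold. A morphism of groups with operations is a group homomorphism preserving the operations of $\Omega_1'$ and $\Omega_2'$. A subgroup with operations is a subgroup closed under all operations in $\Omega_1$ and $\Omega_2$. A topological group with operations is such an object with a topology making all operations continuous. $G$-methods. Let $s(X)$ be the set of all sequences in $X$, a group with operations under termwise operations. A $G$-method for $X$ is a morphism of groups with operations $G\colon c_G(X)\to X$ defined on a subgroup with operations $c_G(X)$ of $s(X)$. A sequence $\mathbf{x}$ is $G$-convergent to $\ell$ if $\mathbf{x}\in c_G(X)$ and $G(\mathbf{x})=\ell$; writing $G(\mathbf{x})=\ell$ includes $\mathbf{x}\in c_G(X)$. $G$ is regular if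 every convergent sequence $\mathbf{x}$ in $X$ lies in $c_G(X)$ and $G(\mathbf{x})=\lim\mathbf{x}$. $G$ preserves the $G$-convergence of subsequences if, whenever $G(\mathbf{x})=\ell$, every subsequence of $\mathbf{x}$ is also $G$-convergent to $\ell$. A map $f\colon X\to X$ (not assumed to be a morphism) is $G$-continuous if for every $\mathbf{x}=(x_n)\in c_G(X)$ the sequence $f(\mathbf{x})=(f(x_n))$ satisfies $G(f(\mathbf{x}))=f(G(\mathbf{x}))$ (in particular $f(\mathbf{x})\in c_G(X)$). $G$-closedness and $G$-compactness. A subset $A$ of $X$ is $G$-closed if whenever $\mathbf{x}$ is a sequence of points of $A$ with $G(\mathbf{x})=\ell$, then $\ell\in A$. It is $G$-compact if every sequence of points in $A$ has a subsequence $\mathbf{y}$ with $G(\mathbf{y})=\ell\in A$. A map $f\colon X\to X$ is $G$-closed if $f(A)$ is $G$-closed for every $G$-closed $A\subseteq X$. *)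

(* Defs.v *)
From HB Require Import structures.
From mathcomp Require Import all_boot.
From mathcomp Require Import boolp classical_sets topology separation_axioms.
From mathcomp Require Import sequences.

Set Implicit Arguments.
Unset Strict Implicit.
Unset Printing Implicit Defensive.

Local Open Scope classical_set_scope.
Local Open Scope group_scope.

(* The groups need not be abelian, so they are instances of [groupType], whose
   law is written multiplicatively: [x * y], [x^-1] and [1] stand for
   x + y, -x and 0. *)

(* Terms over the nullary operation 0, the operations - and +, the unary
   operations U and the binary operations B; variables are numbered. *)
Inductive gwo_term (U B : Type) : Type :=
| TVar of nat
| TUnit
| TInv of gwo_term U B
| TMul of gwo_term U B & gwo_term U B
| TUn of U & gwo_term U B
| TBin of B & gwo_term U B & gwo_term U B.

(* The data (Omega, E) determining one category of groups with operations.
   [gwo_op1] is Omega_1 without -, [gwo_op2] is Omega_2 without +, [gwo_dual]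
   sends * to its opposite operation, and [gwo_identities] contains the
   identities of E, as pairs of terms, beyond those which are required in every
   such category and are axioms of [gwoType] below. *)
Record gwo_theory := GwoTheory {
  gwo_op1 : Type;
  gwo_op2 : Type;
  gwo_dual : gwo_op2 -> gwo_op2;
  gwo_identities : set (gwo_term gwo_op1 gwo_op2 * gwo_term gwo_op1 gwo_op2)
}.

Fixpoint gwo_eval (U B : Type) (X : groupType) (un : U -> X -> X)
    (bin : B -> X -> X -> X) (v : nat -> X) (t : gwo_term U B) : X :=
  match t with
  | TVar i => v i
  | TUnit => 1
  | TInv a => (gwo_eval un bin v a)^-1
  | TMul a b => gwo_eval un bin v a * gwo_eval un bin v b
  | TUn w a => un w (gwo_eval un bin v a)
  | TBin s a b => bin s (gwo_eval un bin v a) (gwo_eval un bin v b)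
  end.

HB.mixin Record Group_hasOperations (T : gwo_theory) X of Group X := {
  unop : gwo_op1 T -> X -> X;
  binop : gwo_op2 T -> X -> X -> X;
  binop_dual : forall s x y, binop (gwo_dual s) x y = binop s y x;
  binopMr : forall s x y z, binop s x (y * z) = binop s x y * binop s x z;
  unopM : forall w x y, unop w (x * y) = unop w x * unop w y;
  unop_binop : forall w s x y, binop s (unop w x) y = unop w (binop s x y);
  gwo_identityP : forall l r, gwo_identities (l, r) ->
    forall v : nat -> X, gwo_eval unop binop v l = gwo_eval unop binop v r
}.

#[short(type="gwoType")]
HB.structure Definition GroupWithOperations (T : gwo_theory) :=
  {X of Group X & Group_hasOperations T X}.

HB.mixin Record isTopologicalGwo (T : gwo_theory) X
    of GroupWithOperations T X & Topological X := {
  gwo_mul_continuous : continuous (fun p : X * X => p.1 * p.2);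
  gwo_inv_continuous : continuous (fun x : X => x^-1);
  unop_continuous : forall w : gwo_op1 T, continuous (unop w : X -> X);
  binop_continuous : forall s : gwo_op2 T,
    continuous (fun p : X * X => binop s p.1 p.2)
}.

#[short(type="topGwoType")]
HB.structure Definition TopologicalGwo (T : gwo_theory) :=
  {X of GroupWithOperations T X & Topological X & isTopologicalGwo T X}.

Section Sequences.
Variables (T : gwo_theory) (X : gwoType T).

Let seq1 : nat -> X := fun=> 1.
Let seqV (x : nat -> X) : nat -> X := fun n => (x n)^-1.
Let seqM (x y : nat -> X) : nat -> X := fun n => x n * y n.
Let seq_un (w : gwo_op1 T) (x : nat -> X) : nat -> X := fun n => unop w (x n).
Let seq_bin (s : gwo_op2 T) (x y : nat -> X) : nat -> X :=
  fun n => binop s (x n) (y n).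

Fact seqMA : associative seqM.
Proof. by move=> x y z; apply/funext => n; apply: mulgA. Qed.
Fact seq1M : left_id seq1 seqM.
Proof. by move=> x; apply/funext => n; apply: mul1g. Qed.
Fact seqM1 : right_id seq1 seqM.
Proof. by move=> x; apply/funext => n; apply: mulg1. Qed.
Fact seqVM : left_inverse seq1 seqV seqM.
Proof. by move=> x; apply/funext => n; apply: mulVg. Qed.
Fact seqMV : right_inverse seq1 seqV seqM.
Proof. by move=> x; apply/funext => n; apply: mulgV. Qed.

HB.instance Definition _ :=
  isGroup.Build (nat -> X) seqMA seq1M seqM1 seqVM seqMV.

Fact seq_bin_dual s x y : seq_bin (gwo_dual s) x y = seq_bin s y x.
Proof. by apply/funext => n; apply: binop_dual. Qed.
Fact seq_binMr s (x y z : nat -> X) :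
  seq_bin s x (y * z) = seq_bin s x y * seq_bin s x z.
Proof. by apply/funext => n; apply: binopMr. Qed.
Fact seq_unM w (x y : nat -> X) : seq_un w (x * y) = seq_un w x * seq_un w y.
Proof. by apply/funext => n; apply: unopM. Qed.
Fact seq_un_bin w s x y : seq_bin s (seq_un w x) y = seq_un w (seq_bin s x y).
Proof. by apply/funext => n; apply: unop_binop. Qed.

Fact seq_evalE (v : nat -> nat -> X) t n :
  gwo_eval seq_un seq_bin v t n = gwo_eval unop binop (v ^~ n) t.
Proof.
elim: t => [//|//|a IH|a IHa b IHb|w a IH|s a IHa b IHb] /=.
- by rewrite -IH.
- by rewrite -IHa -IHb.
- by rewrite -IH.
- by rewrite -IHa -IHb.
Qed.

Fact seq_identityP l r : @gwo_identities T (l, r) ->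
  forall v : nat -> nat -> X,
    gwo_eval seq_un seq_bin v l = gwo_eval seq_un seq_bin v r.
Proof.
move=> lr v; apply/funext => n; rewrite !seq_evalE.
exact: gwo_identityP.
Qed.

HB.instance Definition _ := @Group_hasOperations.Build T (nat -> X)
  seq_un seq_bin seq_bin_dual seq_binMr seq_unM seq_un_bin seq_identityP.

End Sequences.

Record is_gwo_subgroup (T : gwo_theory) (Y : gwoType T) (D : set Y) : Prop := {
  gwo_subgroup1 : D 1;
  gwo_subgroupM : forall x y, D x -> D y -> D (x * y);
  gwo_subgroupV : forall x, D x -> D x^-1;
  gwo_subgroup_un : forall (w : gwo_op1 T) x, D x -> D (unop w x);
  gwo_subgroup_bin : forall (s : gwo_op2 T) x y,
    D x -> D y -> D (binop s x y)
}.

Record is_gwo_morphism_on (T : gwo_theory) (Y Z : gwoType T) (D : set Y)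
    (g : Y -> Z) : Prop := {
  gwo_morphM : forall x y, D x -> D y -> g (x * y) = g x * g y;
  gwo_morph_un : forall (w : gwo_op1 T) x, D x -> g (unop w x) = unop w (g x);
  gwo_morph_bin : forall (s : gwo_op2 T) x y, D x -> D y ->
    g (binop s x y) = binop s (g x) (g y)
}.

(* The morphism G : c_G(X) -> X is represented by a total function on sequences,
   whose values outside [gdom] are irrelevant: it is only used through
   [gconverges] below. *)
Record gmethod (T : gwo_theory) (X : gwoType T) := GMethod {
  gdom : set (nat -> X);
  gfun : (nat -> X) -> X;
  gdom_subgroup : is_gwo_subgroup gdom;
  gfun_morphism : is_gwo_morphism_on gdom gfun
}.

Section GMethods.
Variables (T : gwo_theory) (X : gwoType T) (G : gmethod X).

(* G(x) = l *)
Definition gconverges (x : nat -> X) (l : X) : Prop := gdom G x /\ gfun G x = l.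

Definition is_subsequence (y x : nat -> X) : Prop :=
  exists2 phi : nat -> nat,
    {homo phi : m n / (m < n)%N} & y = x \o phi.

Definition gpreserves_subsequences : Prop :=
  forall x l, gconverges x l -> forall y, is_subsequence y x -> gconverges y l.

Definition gcontinuous (f : X -> X) : Prop :=
  forall x, gdom G x -> gconverges (f \o x) (f (gfun G x)).

Definition gclosed (A : set X) : Prop :=
  forall x l, (forall n, A (x n)) -> gconverges x l -> A l.

Definition gcompact (A : set X) : Prop :=
  forall x, (forall n, A (x n)) ->
    exists2 y, is_subsequence y x & exists2 l, A l & gconverges y l.

Definition gclosed_map (f : X -> X) : Prop :=
  forall A, gclosed A -> gclosed (f @` A).

End GMethods.

Definition gregular (T : gwo_theory) (X : topGwoType T) (G : gmethod X) : Prop :=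
  forall (x : nat -> X) (l : X), x @ \oo --> l -> gconverges G x l.

(* Main.v *)
Require Import Defs.
From mathcomp Require Import all_boot.
From mathcomp Require Import boolp classical_sets topology separation_axioms.
Local Open Scope classical_set_scope.

(** As for the classical statement that a continuous map from a compact space
    to a Hausdorff space is closed, the proof goes through compactness: a
    G-closed subset of the G-compact [X] is G-compact ([gclosed_gcompact]), its
    image under a G-continuous map is G-compact ([gcompact_image]), and a
    G-compact subset is G-closed ([gcompact_gclosed]).  In the last step the
    uniqueness of limits comes from [G] being a function, and preservation of
    G-convergence along subsequences lets a limit found on a subsequence be
    compared with the limit of the whole sequence. *)

Lemma gconverges_unique (T : gwo_theory) (X : gwoType T) (G : gmethod X)
    (x : nat -> X) (l m : X) :
  gconverges G x l -> gconverges G x m -> l = m.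
Proof. by move=> [_ <-] [_ <-]. Qed.

Lemma is_subsequence_comp (T : gwo_theory) (X : gwoType T) (f : X -> X)
    (y x : nat -> X) :
  is_subsequence y x -> is_subsequence (f \o y) (f \o x).
Proof. by move=> [phi phi_incr ->]; exists phi. Qed.

Lemma gclosed_gcompact (T : gwo_theory) (X : gwoType T) (G : gmethod X)
    (A B : set X) :
  gcompact G B -> A `<=` B -> gclosed G A -> gcompact G A.
Proof.
move=> cptB AB closedA x Ax.
have [y yx [l _ yl]] := cptB x (fun n => AB _ (Ax n)).
exists y => //; exists l => //; apply: closedA yl => n.
by case: yx => phi _ ->; apply: Ax.
Qed.

(** A sequence of [f @` A] lifts, by choice, to a sequence of [A]; G-continuity
    carries a G-convergent subsequence of the lift back to the image. *)
Lemma gcompact_image (T : gwo_theory) (X : gwoType T) (G : gmethod X)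
    (f : X -> X) (A : set X) :
  gcontinuous G f -> gcompact G A -> gcompact G (f @` A).
Proof.
move=> fcont cptA z fAz.
have /choice[a aP] n : exists u, A u /\ f u = z n.
  by have [u Au fu] := fAz n; exists u.
have -> : z = f \o a by apply/funext => n /=; have [_ ->] := aP n.
have [y ya [l Al [ydom yl]]] := cptA a (fun n => proj1 (aP n)).
exists (f \o y); first exact: is_subsequence_comp.
by exists (f l); [exists l | rewrite -yl; exact: fcont].
Qed.

(** If [x] is a sequence of [A] with G-limit [l], compactness gives a
    subsequence with a G-limit in [A], and that limit can only be [l]. *)
Lemma gcompact_gclosed (T : gwo_theory) (X : gwoType T) (G : gmethod X)
    (A : set X) :
  gpreserves_subsequences G -> gcompact G A -> gclosed G A.
Proof.
move=> Gsub cptA x l Ax xl.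
have [y yx [m Am ym]] := cptA x Ax.
by rewrite (gconverges_unique _ _ _ _ _ _ (Gsub _ _ xl _ yx) ym).
Qed.

Theorem theorem3p7 (T : gwo_theory) (X : topGwoType T) (G : gmethod X)
    (X_hausdorff : hausdorff_space X)
    (G_regular : gregular G)
    (G_subseq : gpreserves_subsequences G)
    (X_gcompact : gcompact G [set: X])
    (f : X -> X) :
  gcontinuous G f -> gclosed_map G f.
Proof.
move=> fcont A closedA.
apply: gcompact_gclosed => //; apply: gcompact_image => //.
exact: gclosed_gcompact X_gcompact (@subsetT _ A) closedA.
Qed.
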